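(* Let $k\in\mathbb{Z}$ and $n,m\in\mathbb{Z}^+$ with $k\not\equiv0\pmod n$. Then $\chi_{n,k}(P_2)=\chi_{n,k}(P_3)=2$, and $\chi_{n,k}(P_m)=3$ for all $m\ge4$.
   Context: $P_m$ is the path on $m$ vertices. For a graph $G=(V,E)$, a labeling $\ell:V\to\mathbb{Z}$ is proper if adjacent vertices get distinct labels, its order is the size of its image, and it is a closed coloring with remainder $k\bmod n$ if $\sum_{w\in N[v]}\ell(w)\equiv k\pmod n$ for every $v$, where $N[v]$ is the closed neighborhood of $v$. $\chi_{n,k}(G)$ is the minimum order of a proper closed coloring with remainder $k\bmod n$ (it does not exist if there is none). *)

(* Defs.v *)
From HB Require Import structures.
From mathcomp Require Import all_boot all_order all_algebra.

Set Implicit Arguments.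
Unset Strict Implicit.
Unset Printing Implicit Defensive.

Import GRing.Theory.
Local Open Scope ring_scope.

Record simple_graph := SimpleGraph {
  vertex :> finType;
  adj : rel vertex;
  adj_sym : symmetric adj;
  adj_irr : irreflexive adj
}.

Definition closed_nbhd (G : simple_graph) (v : G) : {set G} :=
  [set w | (w == v) || adj v w].

Definition proper_labeling (G : simple_graph) (l : G -> int) : Prop :=
  forall u v : G, adj u v -> l u <> l v.

Definition labeling_order (G : simple_graph) (l : G -> int) : nat :=
  size (undup (codom l)).

Definition closed_coloring (G : simple_graph) (n : nat) (k : int)
    (l : G -> int) : Prop :=
  forall v : G, (\sum_(w in closed_nbhd v) l w = k %[mod n])%Z.

(* [chi_eq n k G c] states that chi_{n,k}(G) exists and equals [c].  It is a
   relation, since the minimum does not exist when G has no proper closed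
   coloring with remainder k mod n. *)
Definition chi_eq (n : nat) (k : int) (G : simple_graph) (c : nat) : Prop :=
  (exists l : G -> int,
      [/\ proper_labeling l, closed_coloring n k l & labeling_order l = c]) /\
  (forall l : G -> int,
      proper_labeling l -> closed_coloring n k l -> (c <= labeling_order l)%N).

Definition path_adj (m : nat) : rel 'I_m :=
  fun i j => (i.+1 == j :> nat) || (j.+1 == i :> nat).

Lemma path_adj_sym m : symmetric (@path_adj m).
Proof. by move=> i j; rewrite /path_adj orbC. Qed.

Lemma path_adj_irr m : irreflexive (@path_adj m).
Proof. by move=> i; rewrite /path_adj orbb gtn_eqF. Qed.

Definition path_graph (m : nat) : simple_graph :=
  SimpleGraph (@path_adj_sym m) (@path_adj_irr m).

(* Main.v *)
(** Along a path the closed-neighbourhood sums make the labels l1, l2, l3, ...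
    satisfy l1 + l2 = k, l3 = 0 and l4 = l1 modulo n.  With only two labels a
    proper labeling alternates, so that l1 = l3 and l2 = l4, which forces every
    residue, hence k, to vanish; thus three labels are needed from four vertices
    on.  Conversely the 3-periodic word 0, k, n, 0, k, n, ... works unless
    m = 1 mod 3, where k, 0, n, k, 0, n, ..., k does. *)
Require Import Defs.
From mathcomp Require Import all_boot all_order all_algebra.
From mathcomp Require Import zify ring.

Set Implicit Arguments.
Unset Strict Implicit.
Unset Printing Implicit Defensive.

Import GRing.Theory.

Lemma leq_labeling_order (G : simple_graph) (l : G -> int) (s : seq G) :
  uniq (map l s) -> (size s <= labeling_order l)%N.
Proof.
move=> us; rewrite -(size_map l) /labeling_order; apply: uniq_leq_size => // x.
by case/mapP=> v _ ->; rewrite mem_undup codom_f.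
Qed.

Lemma labeling_order_leq (G : simple_graph) (l : G -> int) (s : seq int) :
  (forall v, l v \in s) -> (labeling_order l <= size s)%N.
Proof.
move=> ls; apply: uniq_leq_size (undup_uniq _) _ => x.
by rewrite mem_undup => /codomP[v ->].
Qed.

(** Labels come from a function on [nat], so that neighbours are reached by successor and
    predecessor; the two conditionals discard the neighbours missing at the ends. *)
Lemma sum_closed_nbhd_path (m : nat) (F : nat -> int) (v : path_graph m) :
  (\sum_(w in closed_nbhd v) F (w : 'I_m) =
   F (v : 'I_m) + (if ((v : 'I_m).+1 < m)%N then F (v : 'I_m).+1 else 0)
   + (if (v : 'I_m) : nat is u.+1 then F u else 0))%R.
Proof.
have sum1 i : (\sum_(w < m) (if w == i :> nat then F w else 0) =
    if (i < m)%N then F i else 0)%R by rewrite -big_mkcond big_ord1_eq.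
have -> : (\sum_(w in closed_nbhd v) F (w : 'I_m) =
  \sum_(w < m) (if w == (v : 'I_m) :> nat then F w else 0) +
  \sum_(w < m) (if w == (v : 'I_m).+1 :> nat then F w else 0) +
  \sum_(w < m) (if w.+1 == (v : 'I_m) :> nat then F w else 0))%R.
  (* The positions [v], [v.+1] and [v.-1] exclude one another, so at most one of the three
     conditionals holds at each [w]. *)
  rewrite -!big_split /= big_mkcond; apply: eq_bigr => w _ /=.
  rewrite inE /= /path_adj -val_eqE /= (eq_sym _ (w : nat)).
  by do 3![case: eqP => ? /=]; rewrite ?addr0 ?add0r //; lia.
rewrite !sum1 ltn_ord; congr (_ + _)%R.
case: v => [[|u] lt_um] /=; first by rewrite big1.
under eq_bigr do rewrite eqSS.
by rewrite sum1 ltnW.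
Qed.

(** The hypotheses treat the first, last and interior vertices in turn; the last vertex is [m.+1],
    with [m] as its only neighbour. *)
Lemma path_closed_coloring (m n : nat) (k : int) (F : nat -> int) :
  (F 0%N + F 1%N = k %[mod n])%Z ->
  (F m + F m.+1 = k %[mod n])%Z ->
  (forall i, F i + F i.+1 + F i.+2 = k %[mod n])%Z ->
  closed_coloring n k (fun v : path_graph m.+2 => F (v : 'I_m.+2)).
Proof.
move=> F_first F_last F_mid v; rewrite sum_closed_nbhd_path.
case: v => [[|u] lt_um] /=; first by rewrite addr0.
case: ifP => [_|ge_um]; first by rewrite -(F_mid u); congr modz; ring.
have -> : u = m by lia.
by rewrite -F_last addr0 addrC.
Qed.

Lemma path_proper_labeling (m : nat) (F : nat -> int) :
  (forall i, F i <> F i.+1) ->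
  proper_labeling (fun v : path_graph m => F (v : 'I_m)).
Proof.
by move=> F_adj u v /orP[]/eqP <- => [|/esym]; apply: F_adj.
Qed.

Lemma two_leq_path_order (m : nat) (l : path_graph m.+2 -> int) :
  proper_labeling l -> (2 <= labeling_order l)%N.
Proof.
move=> pl; apply: (leq_labeling_order (l := l) (s := [:: inord 0; inord 1])).
rewrite /= inE andbT; apply/eqP/pl.
by rewrite /= /path_adj !inordK.
Qed.

(** If the labels of vertices 0 and 2 differ, then vertices 0, 1, 2 carry three labels; likewise for
    1, 2, 3. Otherwise the sums at vertices 0, 1, 2 force [n] to divide [k]. *)
Lemma three_leq_path_order (m n : nat) (k : int) (l : path_graph m.+4 -> int) :
  ~ (k = 0 %[mod n])%Z ->
  proper_labeling l -> closed_coloring n k l -> (3 <= labeling_order l)%N.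
Proof.
move=> k_neq0 pl cl.
(* [inord] is meaningful only below [m.+4], hence the bounds in [nF] and [cF]. *)
pose F i := l (inord i).
have nF i : (i.+1 < m.+4)%N -> F i <> F i.+1.
  by move=> ?; apply: pl; rewrite /= /path_adj !inordK // ?eqxx //; lia.
have cF i : (i < m.+4)%N ->
   (F i + (if i.+1 < m.+4 then F i.+1 else 0)
    + (if i is u.+1 then F u else 0) = k %[mod n])%Z.
  move=> lt_im; have := cl (inord i).
  rewrite (eq_bigr (fun w : 'I_m.+4 => F w)) => [|w _]; last first.
    by rewrite /F inord_val.
  by rewrite sum_closed_nbhd_path inordK.
case: (F 0 =P F 2) => [e02|n02]; last first.
  apply: (leq_labeling_order (l := l) (s := [:: inord 0; inord 1; inord 2])).
  have := nF 0; have := nF 1; rewrite /= !inE -/(F 0) -/(F 1) -/(F 2); lia.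
case: (F 1 =P F 3) => [e13|n13]; last first.
  apply: (leq_labeling_order (l := l) (s := [:: inord 1; inord 2; inord 3])).
  have := nF 1; have := nF 2; rewrite /= !inE -/(F 1) -/(F 2) -/(F 3); lia.
case: k_neq0; apply/eqP; rewrite eqz_mod_dvd.
have /eqP := cF 0 isT; have /eqP := cF 1 isT; have /eqP := cF 2 isT.
rewrite /= !eqz_mod_dvd -e02 -e13.
set a := F 0%N; set b := F 1%N => d2 d1 d0.
(* n divides a + b - k, 2 a + b - k and a + 2 b - k, hence k. *)
have -> : (k - 0 = (b + a + a - k) + (a + b + b - k) - (a + b + 0 - k) *+ 3)%R.
  by ring.
by rewrite rpredB ?rpredMn // rpredD.
Qed.

(** In the words 0, k and 0, k, 0 vertex 1 alone has label [k], and it lies in every closed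
    neighbourhood. *)
Lemma alternating_path (m n : nat) (k : int) :
  ~ (k = 0 %[mod n])%Z -> (m < 2)%N -> chi_eq n k (path_graph m.+2) 2.
Proof.
move=> k_neq0 lt_m2; split=> [|l pl _]; last exact: two_leq_path_order.
have k0 : k <> 0 by move=> k0; apply: k_neq0; rewrite k0.
pose F i : int := if odd i then k else 0.
have pF : proper_labeling (fun v : path_graph m.+2 => F (v : 'I_m.+2)).
  by apply: path_proper_labeling => i; rewrite /F /=; case: (odd i) => //= /esym.
exists (fun v : path_graph m.+2 => F (v : 'I_m.+2)); split=> // [v|].
  rewrite sum_closed_nbhd_path /F.
  by case: m lt_m2 v {pF} => [|[|//]] _ [[|[|[|//]]] lt_v] //=;
    rewrite ?addr0 ?add0r.
apply/eqP; rewrite eqn_leq two_leq_path_order // andbT.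
apply: (labeling_order_leq (s := [:: 0%R; k])) => v.
by rewrite /F !inE; case: ifP; rewrite eqxx ?orbT.
Qed.

Definition periodic3 (a b c : int) (i : nat) : int :=
  nth 0%R [:: a; b; c] (i %% 3).

(** Three consecutive labels are [a], [b], [c] up to rotation, so every interior sum is [a + b + c],
    congruent to [k]. Only the sum at the last vertex depends on the length of the path. *)
Lemma periodic3_chi (a b c k : int) (m n : nat) :
  ~ (k = 0 %[mod n])%Z -> uniq [:: a; b; c] ->
  (a + b = k %[mod n])%Z -> (c = 0 %[mod n])%Z ->
  (periodic3 a b c m.+2 + periodic3 a b c m.+3 = k %[mod n])%Z ->
  chi_eq n k (path_graph m.+4) 3.
Proof.
set F := periodic3 a b c => k_neq0 abc abk c0 F_last.
split=> [|l pl cl]; last exact: three_leq_path_order cl.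
have F_S i : [\/ [/\ F i = a, F i.+1 = b & F i.+2 = c],
                 [/\ F i = b, F i.+1 = c & F i.+2 = a] |
                 [/\ F i = c, F i.+1 = a & F i.+2 = b]].
  rewrite /F /periodic3 -[i.+2]addn2 -[i.+1]addn1 -(modnDml i 1) -(modnDml i 2).
  by case: (i %% 3)%N (ltn_pmod i (isT : 0 < 3)%N) => [|[|[|//]]] _;
    [apply: Or31 | apply: Or32 | apply: Or33].
have pF : proper_labeling (fun v : path_graph m.+4 => F (v : 'I_m.+4)).
  apply: path_proper_labeling => i; move: abc; rewrite /= !inE.
  by case: (F_S i) => -[-> -> _]; clear; lia.
have cF : closed_coloring n k (fun v : path_graph m.+4 => F (v : 'I_m.+4)).
  apply: path_closed_coloring => // i.
  have abck : (a + b + c = k %[mod n])%Z.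
    by rewrite -modzDmr c0 mod0z addr0.
  by rewrite -abck; case: (F_S i) => -[-> -> ->]; congr modz; ring.
exists (fun v : path_graph m.+4 => F (v : 'I_m.+4)); split=> //.
apply/eqP; rewrite eqn_leq (three_leq_path_order k_neq0 pF cF) andbT.
apply: (labeling_order_leq (s := [:: a; b; c])) => v.
by case: (F_S (v : 'I_m.+4)) => -[-> _ _]; rewrite !inE eqxx ?orbT.
Qed.

Theorem theorem4p2 (k : int) (n : nat) (n_gt0 : (0 < n)%N)
    (k_neq0 : ~ (k = 0 %[mod n])%Z) :
  chi_eq n k (path_graph 2) 2 /\
  chi_eq n k (path_graph 3) 2 /\
  (forall m : nat, (4 <= m)%N -> chi_eq n k (path_graph m) 3).
Proof.
split; first exact: alternating_path.
split; first exact: alternating_path.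
case=> [|[|[|[|m]]]] // _.
have nn : (n = 0 %[mod n])%Z by rewrite modzz mod0z.
have k0 : k <> 0 by move=> k0; apply: k_neq0; rewrite k0.
have kn : k <> n by move=> kn; apply: k_neq0; rewrite kn.
have modm r : ((m + r) %% 3 = (m %% 3 + r) %% 3)%N by rewrite modnDml.
(* The last two labels sit at [m.+2] and [m.+3]. If 3 divides [m] they are [c] and [a], so [k] must
   come first. Otherwise they are [a], [b] or [b], [c], and 0, k, n works. The label [n] acts as a
   second zero modulo [n], distinct from 0. *)
have [m0|m0] := eqVneq (m %% 3)%N 0%N.
  apply: (periodic3_chi (a := k) (b := 0) (c := n)) => //.
  - by rewrite /= !inE; clear - k0 kn n_gt0; lia.
  - by rewrite addr0.
  rewrite /periodic3 -[m.+3]addn3 -[m.+2]addn2 !modm m0 /=.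
  by rewrite -modzDml nn mod0z add0r.
apply: (periodic3_chi (a := 0) (b := k) (c := n)) => //.
- by rewrite /= !inE; clear - k0 kn n_gt0; lia.
- by rewrite add0r.
rewrite /periodic3 -[m.+3]addn3 -[m.+2]addn2 !modm.
case: (m %% 3)%N m0 (ltn_pmod m (isT : 0 < 3)%N) => [|[|[|//]]] //= _ _.
  by rewrite add0r.
by rewrite -modzDmr nn mod0z addr0.
Qed.
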